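(* Let $(X,\sigma,\tau)$ be a solution. (1) $(X,\sigma,\tau)$ is a multipermutation solution of level $2$ if and only if it is medial. (2) If $(X,\sigma,\tau)$ is distributive, then it is a multipermutation solution of level $2$.
   Context: A solution is a triple $(X,\sigma,\tau)$ with $X$ a set of arbitrary cardinality and $\sigma,\tau\colon X\times X\to X$. Write $\sigma_x=\sigma(x,\cdot)$, $\tau_y=\tau(\cdot,y)$ and $r(x,y)=(\sigma_x(y),\tau_y(x))$. It is required that: (braid relation) $(\mathrm{id}\times r)(r\times \mathrm{id})(\mathrm{id}\times r)=(r\times \mathrm{id})(\mathrm{id}\times r)(r\times \mathrm{id})$ on $X^3$; (non-degenerate) all $\sigma_x$ and $\tau_y$ are bijections of $X$; (involutive) $r^2=\mathrm{id}_{X^2}$. Retraction: define $x\sim y$ iff $\sigma_x=\sigma_y$. It is known that $\sigma,\tau$ induce well-defined operations on $X/\mathord{\sim}$, making it a solution $\mathrm{Ret}(X,\sigma,\tau)$, with $\overline\sigma([x],[y])=[\sigma(x,y)]$ and $\overline\tau([x],[y])=[\tau(x,y)]$. Put $\mathrm{Ret}^0(X,\sigma,\tau)=(X,\sigma,\tau)$ and $\mathrm{Ret}^k(X,\sigma,\tau)=\mathrm{Ret}(\mathrm{Ret}^{k-1}(X,\sigma,\tau))$ for $k\ge 1$. A solution is called a multipermutation solution of level $m$ if $m$ is the least non-negative integer with $|\mathrm{Ret}^m(X,\sigma,\tau)|=1$. A solution is medial if, with $x\circ y=\sigma_x(y)$, one has $(x\circ y)\circ(z\circ t)=(x\circ z)\circ(y\circ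 t)$ for all $x,y,z,t\in X$. It is distributive if, with also $x\bullet y=\tau_y(x)$, one has $x\circ(y\circ z)=(x\circ y)\circ(x\circ z)$ and $(y\bullet z)\bullet x=(y\bullet x)\bullet(z\bullet x)$ for all $x,y,z\in X$.
   Formalization: ''Multipermutation solution of level 2'' is read as level at most 2, and X is assumed nonempty; the one-element solution (medial and distributive, level 0) and the empty solution (medial and distributive, no level) refute the literal claim. *)

(* Defs.v *)
From mathcomp Require Import all_boot.
From mathcomp Require Import boolp.

Set Implicit Arguments.
Unset Strict Implicit.
Unset Printing Implicit Defensive.

Local Open Scope quotient_scope.

Section YangBaxterMap.

Variables (X : Type) (sigma tau : X -> X -> X).

Definition yb_map (p : X * X) : X * X := (sigma p.1 p.2, tau p.1 p.2).

(* r x id and id x r on X^3 = (X * X) * X *)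
Definition yb_map12 (t : X * X * X) : X * X * X :=
  let p := yb_map (t.1.1, t.1.2) in (p.1, p.2, t.2).

Definition yb_map23 (t : X * X * X) : X * X * X :=
  let p := yb_map (t.1.2, t.2) in (t.1.1, p.1, p.2).

(* [tau x y] is tau(x, y), hence the bijection tau_y is [tau^~ y]. *)
Record is_solution : Prop := IsSolution {
  yb_braid : forall t,
    yb_map23 (yb_map12 (yb_map23 t)) = yb_map12 (yb_map23 (yb_map12 t));
  yb_sigma_bij : forall x, bijective (sigma x);
  yb_tau_bij : forall y, bijective (tau^~ y);
  yb_invol : forall p, yb_map (yb_map p) = p
}.

End YangBaxterMap.

Record solution := Solution {
  carrier :> Type;
  sigma : carrier -> carrier -> carrier;
  tau : carrier -> carrier -> carrier;
  solutionP : is_solution sigma tau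
}.

Section Identities.

Variables (X : Type) (s t : X -> X -> X).
Hypothesis solX : is_solution s t.

Lemma sol_sigmaM x y z : s x (s y z) = s (s x y) (s (t x y) z).
Proof. by have [] := yb_braid solX (x, y, z). Qed.

Lemma sol_tauM x y z : t (t x y) z = t (t x (s y z)) (t y z).
Proof. by have [] := yb_braid solX (x, y, z). Qed.

Lemma sol_mid x y z :
  s (t x (s y z)) (t y z) = t (s x y) (s (t x y) z).
Proof. by have [] := yb_braid solX (x, y, z). Qed.

Lemma sol_sigma_invol x y : s (s x y) (t x y) = x.
Proof. by have [] := yb_invol solX (x, y). Qed.

Lemma sol_tau_invol x y : t (s x y) (t x y) = y.
Proof. by have [] := yb_invol solX (x, y). Qed.

Lemma sol_sigma_inj x : injective (s x).
Proof. exact: bij_inj (yb_sigma_bij solX x). Qed.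

Lemma sol_tau_inj y : injective (t^~ y).
Proof. exact: bij_inj (yb_tau_bij solX y). Qed.

Lemma sol_sigma_surj x w : exists y, s x y = w.
Proof. by have [g _ gK] := yb_sigma_bij solX x; exists (g w). Qed.

Lemma sol_tau_surj y w : exists x, t x y = w.
Proof. by have [g _ gK] := yb_tau_bij solX y; exists (g w). Qed.

Lemma sol_dual : is_solution (fun x y => t y x) (fun x y => s y x).
Proof.
split=> [[[x y] z]|x|y|[x y]].
- rewrite /yb_map12 /yb_map23 /yb_map /=.
  by rewrite -sol_tauM -sol_mid -sol_sigmaM.
- exact: (yb_tau_bij solX).
- exact: (yb_sigma_bij solX).
- by rewrite /yb_map /= sol_tau_invol sol_sigma_invol.
Qed.

(* Conjugation of sigma_x and tau_x^-1 by the bijection T : w |-> sigma_w^-1 w,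
   pointwise: [y = T w] reads [s w y = w]. *)
Lemma sol_diag w y : s w y = w -> t w y = y.
Proof.
by move=> e; apply: (@sol_sigma_inj w); have := sol_sigma_invol w y; rewrite e.
Qed.

Lemma sol_conj x v y : s (t v x) y = t v x -> s v (s x y) = v.
Proof. by move=> e; rewrite sol_sigmaM e sol_sigma_invol. Qed.

Lemma sol_sigma_tau x x' : s x = s x' -> t^~ x = t^~ x'.
Proof.
move=> exx'; apply: functional_extensionality_dep => v.
have [y ey] := sol_sigma_surj (t v x) (t v x).
have [v' ev'] := sol_tau_surj x' (t v x).
have /sol_diag tv := sol_conj ey.
have /sol_diag tv' : s v' (s x' y) = v' by apply: sol_conj; rewrite ev'.
rewrite -exx' in tv'.
suff vv' : v = v' by rewrite -ev' vv'.
by apply: (@sol_tau_inj (s x y)); rewrite /= tv tv'.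
Qed.

End Identities.

Section RetractionCongruence.

Variables (X : Type) (s t : X -> X -> X).
Hypothesis solX : is_solution s t.

Lemma sol_tau_sigma x x' : t^~ x = t^~ x' -> s x = s x'.
Proof. exact: (@sol_sigma_tau _ _ _ (sol_dual solX)). Qed.

Lemma sol_sim_sigma x x' y y' :
  s x = s x' -> s y = s y' -> s (s x y) = s (s x' y').
Proof.
move=> exx' eyy'; rewrite exx'; apply: functional_extensionality_dep => z.
have [z' <-] := sol_sigma_surj solX (t x' y) z.
rewrite -(sol_sigmaM solX) (congr1 (fun f => f x') (sol_sigma_tau solX eyy')).
by rewrite -(sol_sigmaM solX) eyy'.
Qed.

Lemma sol_sim_sigmaI x y y' : s (s x y) = s (s x y') -> s y = s y'.
Proof.
move=> e; apply: functional_extensionality_dep => z.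
apply: (@sol_sigma_inj _ _ _ solX x); rewrite [LHS](sol_sigmaM solX) [RHS](sol_sigmaM solX) e.
suff -> : t x y = t x y' by [].
apply: (@sol_sigma_inj _ _ _ solX (s x y)).
by rewrite (sol_sigma_invol solX) e (sol_sigma_invol solX).
Qed.

End RetractionCongruence.

Section RetractionCongruenceTau.

Variables (X : Type) (s t : X -> X -> X).
Hypothesis solX : is_solution s t.

Lemma sol_sim_tau x x' y y' :
  s x = s x' -> s y = s y' -> s (t x y) = s (t x' y').
Proof.
move=> /(sol_sigma_tau solX) exx' /(sol_sigma_tau solX) eyy'.
by apply: (sol_tau_sigma solX); exact: (sol_sim_sigma (sol_dual solX)).
Qed.

Lemma sol_sim_tauI x x' y : s (t x y) = s (t x' y) -> s x = s x'.
Proof.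
move=> /(sol_sigma_tau solX) e; apply: (sol_tau_sigma solX).
exact: (sol_sim_sigmaI (sol_dual solX) e).
Qed.

End RetractionCongruenceTau.

Section Retraction.

Variable S : solution.

(* [{classic S}] is the type S with the choice structure required by
   [generic_quotient]. *)
Definition ret_rel : rel {classic S} := fun x y => `[< sigma x = sigma y >].

Lemma ret_rel_refl : reflexive ret_rel.
Proof. by move=> x; apply/asboolP. Qed.

Lemma ret_rel_sym : symmetric ret_rel.
Proof. by move=> x y; apply/asboolP/asboolP. Qed.

Lemma ret_rel_trans : transitive ret_rel.
Proof. by move=> y x z /asboolP exy /asboolP eyz; apply/asboolP; rewrite exy. Qed.

Canonical ret_equiv := EquivRel ret_rel ret_rel_refl ret_rel_sym ret_rel_trans.

Definition ret_carrier : Type := {eq_quot ret_equiv}.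

Definition ret_pi (x : S) : ret_carrier := \pi_({eq_quot ret_equiv}) x.
Definition ret_repr (u : ret_carrier) : S := repr (u : {eq_quot ret_equiv}).

Lemma ret_piP x y : ret_pi x = ret_pi y <-> sigma x = sigma y.
Proof.
by split=> [/eqmodP/asboolP //|e]; apply/eqmodP/asboolP.
Qed.

Lemma ret_reprK u : ret_pi (ret_repr u) = u.
Proof. exact: reprK. Qed.

Lemma sigma_repr x : sigma (ret_repr (ret_pi x)) = sigma x.
Proof. by apply/ret_piP; rewrite ret_reprK. Qed.

(* Representatives are chosen; [ret_sigmaE] and [ret_tauE] show that the choice
   is immaterial. *)
Definition ret_sigma (u v : ret_carrier) : ret_carrier :=
  ret_pi (sigma (ret_repr u) (ret_repr v)).

Definition ret_tau (u v : ret_carrier) : ret_carrier :=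
  ret_pi (tau (ret_repr u) (ret_repr v)).

Lemma ret_sigmaE x y : ret_sigma (ret_pi x) (ret_pi y) = ret_pi (sigma x y).
Proof.
by apply/ret_piP; apply: (sol_sim_sigma (solutionP S)); rewrite sigma_repr.
Qed.

Lemma ret_tauE x y : ret_tau (ret_pi x) (ret_pi y) = ret_pi (tau x y).
Proof.
by apply/ret_piP; apply: (sol_sim_tau (solutionP S)); rewrite sigma_repr.
Qed.

Lemma inj_surj_bij (T T' : Type) (f : T -> T') :
  injective f -> (forall y, exists x, f x = y) -> bijective f.
Proof.
move=> fI /choice [g gK].
by exists g => // x; apply: fI; rewrite gK.
Qed.

Lemma ret_is_solution : is_solution ret_sigma ret_tau.
Proof.
have solS := solutionP S.
split=> [[[u v] w]|u|v|[u v]].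
- rewrite -(ret_reprK u) -(ret_reprK v) -(ret_reprK w).
  rewrite /yb_map12 /yb_map23 /yb_map /= !(ret_sigmaE, ret_tauE).
  by rewrite -(sol_sigmaM solS) (sol_mid solS) -(sol_tauM solS).
- apply: inj_surj_bij => [v w|w]; rewrite -(ret_reprK u) -(ret_reprK w).
    rewrite -(ret_reprK v) !ret_sigmaE => /ret_piP e.
    by apply/ret_piP; exact: (sol_sim_sigmaI solS e).
  have [y ey] := sol_sigma_surj solS (ret_repr u) (ret_repr w).
  by exists (ret_pi y); rewrite ret_sigmaE ey.
- apply: inj_surj_bij => [u w|w]; rewrite -(ret_reprK v) -(ret_reprK w).
    rewrite -(ret_reprK u) !ret_tauE => /ret_piP e.
    by apply/ret_piP; exact: (sol_sim_tauI solS e).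
  have [x ex] := sol_tau_surj solS (ret_repr v) (ret_repr w).
  by exists (ret_pi x); rewrite ret_tauE ex.
- rewrite -(ret_reprK u) -(ret_reprK v) /yb_map /= !(ret_sigmaE, ret_tauE).
  by rewrite (sol_sigma_invol solS) (sol_tau_invol solS).
Qed.

Definition Ret : solution := Solution ret_is_solution.

End Retraction.

Definition Ret_iter (k : nat) (S : solution) : solution := iter k Ret S.

Definition one_point (X : Type) : Prop := exists x : X, forall y : X, y = x.

Definition multipermutation (m : nat) (S : solution) : Prop :=
  one_point (Ret_iter m S) /\
  forall k : nat, k < m -> ~ one_point (Ret_iter k S).

(* x o y = sigma_x(y) is [sigma x y]. *)
Definition medial (S : solution) : Prop :=
  forall x y z t : S,
    sigma (sigma x y) (sigma z t) = sigma (sigma x z) (sigma y t).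

(* In the second identity y . z = tau_z(y) is [tau y z]. *)
Definition distributive (S : solution) : Prop :=
  forall x y z : S,
    sigma x (sigma y z) = sigma (sigma x y) (sigma x z) /\
    tau (tau y z) x = tau (tau y x) (tau z x).

(* Main.v *)
Require Import Defs.
From mathcomp Require Import all_boot.
From mathcomp Require Import boolp.

(** As Ret preserves points, having level at most 2 means that Ret (Ret S) is a
    point, which unfolds to:
    [sigma (sigma x z)] does not depend on x.  The proof compares this property
    ([one_point_Ret2P]) with the identities in S, where s_x = [sigma x] and
    t_y = [tau^~ y]:
      mediality        s_(s_x y) s_z = s_(s_x z) s_y,
      braid relation   s_x s_y = s_(s_x y) s_(t_y x),
      involutivity     x = s_(s_x y) (t_y x).

    Level at most 2 implies medial: given y and z, choose x' with t_y x' = z.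
    The braid relation at (x', y) then reads s_(s_x' y) s_z = s_x' s_y, and
    involutivity says that x' has the form s_w z.  Since s_(s_w z) is independent
    of w, this is the medial law.

    Medial implies level at most 2: the medial law makes s_(s_x z)^-1 s_(s_x w)
    equal to s_w s_z^-1, hence independent of x.  So s_(s_x w) = s_(s_x' w)
    holds for all w once it holds for a single w ([medial_one_to_all]).  For
    x' = s_x y it holds at w = t_y x: both sides are s_x, the left one by the
    braid and medial laws, the right one by involutivity.  As s_x is onto, every
    x' has this form.

    Distributive implies level at most 2: comparing the second distributive law
    with the braid relation for tau gives t_(s_y z) = t_z, and tau determines
    sigma, so that s_(s_y z) = s_z. *)

Set Implicit Arguments.
Unset Strict Implicit.
Unset Printing Implicit Defensive.

Lemma one_pointP (X : Type) :
  one_point X <-> inhabited X /\ forall x y : X, x = y.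
Proof.
split=> [[x xP]|[[x] eqX]]; last by exists x.
by split=> // y z; rewrite (xP y) (xP z).
Qed.

Lemma inhabited_Ret (S : solution) : inhabited S -> inhabited (Ret S).
Proof. by case=> x; exists; exact: ret_pi x. Qed.

Lemma one_point_RetP (S : solution) (S_nonempty : inhabited S) :
  one_point (Ret S) <-> forall x y : S, sigma x = sigma y.
Proof.
split=> [/one_pointP[_ eqR] x y|eqs]; first exact/ret_piP/eqR.
apply/one_pointP; split=> [|u v]; first exact: inhabited_Ret.
by rewrite -(ret_reprK u) -(ret_reprK v); apply/ret_piP.
Qed.

Lemma one_point_Ret (S : solution) : one_point S -> one_point (Ret S).
Proof.
by case/one_pointP=> S0 eqS; apply/one_point_RetP => // x y; rewrite (eqS x y).
Qed.

Lemma one_point_Ret_iter (S : solution) (m n : nat) :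
  m <= n -> one_point (Ret_iter m S) -> one_point (Ret_iter n S).
Proof.
move=> /subnK <- Sm; elim: (n - m) => [//|k]; exact: one_point_Ret.
Qed.

Lemma multipermutation_leP (S : solution) (n : nat) :
  (exists2 m : nat, m <= n & multipermutation m S) <-> one_point (Ret_iter n S).
Proof.
split=> [[m le_mn [Sm _]]|Sn]; first exact: one_point_Ret_iter Sm.
have exS : exists k, `[< one_point (Ret_iter k S) >] by exists n; apply/asboolP.
case: (ex_minnP exS) => m /asboolP Sm minm.
exists m; first by apply: minm; apply/asboolP.
by split=> // k lt_km /asboolP/minm; rewrite leqNgt lt_km.
Qed.

Lemma one_point_Ret2P (S : solution) (S_nonempty : inhabited S) :
  one_point (Ret_iter 2 S) <->
  forall x x' z : S, sigma (sigma x z) = sigma (sigma x' z).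
Proof.
split=> [/(one_point_RetP (inhabited_Ret S_nonempty)) eqR x x' z|eqs].
  apply/ret_piP; rewrite -!ret_sigmaE.
  exact: (congr1 (fun f => f (ret_pi z)) (eqR (ret_pi x) (ret_pi x'))).
apply/(one_point_RetP (inhabited_Ret S_nonempty)) => u v; apply/funext => w.
exact/ret_piP/eqs.
Qed.

Lemma sigma_sigma_const_medial (S : solution) :
  (forall x x' z : S, sigma (sigma x z) = sigma (sigma x' z)) -> medial S.
Proof.
move=> eqs x y z t; have solS := solutionP S.
have [x' x'y] := sol_tau_surj solS y z.
have x'E : sigma (sigma x' y) z = x' by rewrite -x'y (sol_sigma_invol solS).
rewrite (eqs x x' y) -{1}x'y -(sol_sigmaM solS).
by rewrite (eqs x (sigma x' y) z) x'E.
Qed.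

(** The medial law says s_(s_x w) = s_(s_x z) s_w s_z^-1, whose right-hand side
    depends on x only through s_(s_x z). *)
Lemma medial_one_to_all (S : solution) (x x' z : S) :
  medial S -> sigma (sigma x z) = sigma (sigma x' z) ->
  forall w, sigma (sigma x w) = sigma (sigma x' w).
Proof.
move=> medS eqz w; apply/funext => v.
have [u <-] := sol_sigma_surj (solutionP S) z v.
by rewrite medS eqz -medS.
Qed.

Lemma medial_sigma_sigma_const (S : solution) :
  medial S -> forall x x' z : S, sigma (sigma x z) = sigma (sigma x' z).
Proof.
move=> medS x x'; have solS := solutionP S.
have [y <-] := sol_sigma_surj solS x x'.
apply: (medial_one_to_all (z := tau x y)) => //.
rewrite (sol_sigma_invol solS); apply/funext => v.
(* The braid relation concerns s_x s_y, so v is written as s_y u. *)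
have [u <-] := sol_sigma_surj solS y v.
by rewrite medS -(sol_sigmaM solS).
Qed.

Lemma distributive_sigma_sigma (S : solution) :
  distributive S -> forall y z : S, sigma (sigma y z) = sigma z.
Proof.
move=> distS y z; have solS := solutionP S.
apply: (sol_tau_sigma solS); apply/funext => x.
apply: (sol_tau_inj solS (y := tau y z)).
by rewrite /= -(sol_tauM solS); have [_] := distS z x y.
Qed.

Theorem theorem7p6 (S : solution) (S_nonempty : inhabited S) :
  ((exists2 m : nat, m <= 2 & multipermutation m S) <-> medial S) /\
  (distributive S -> exists2 m : nat, m <= 2 & multipermutation m S).
Proof.
split.
  apply: iff_trans (multipermutation_leP S 2) _.
  apply: iff_trans (one_point_Ret2P S_nonempty) _.
  split; [exact: sigma_sigma_const_medial | exact: medial_sigma_sigma_const].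
move=> distS; apply/multipermutation_leP/(one_point_Ret2P S_nonempty) => x x' z.
by rewrite !distributive_sigma_sigma.
Qed.
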